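(* Let $\kappa$ be a regular uncountable cardinal and $\lambda>\kappa$ a cardinal. Let $H$ be an ideal on $P_\kappa(\lambda)$ such that $\mathrm{cof}(H)<\mathfrak d^\kappa_{\kappa,\lambda}$. Then $\mathfrak a_H>\kappa$ and $H$ is a weak $\pi$-point.
   Context: For a cardinal $\mu$ and a set $A$, $P_\mu(A)=\{a\subseteq A:|a|<\mu\}$. An ideal on an infinite set $S$ is a collection $K$ of subsets of $S$ containing all singletons, closed under subsets and finite unions, with $S\notin K$; $K^+=P(S)\setminus K$; $\mathrm{cof}(K)$ is the least cardinality of an $X\subseteq K$ with $K=\bigcup_{A\in X}P(A)$. $I_{\kappa,\lambda}$ is the set of all $A\subseteq P_\kappa(\lambda)$ such that $A\cap\{b\in P_\kappa(\lambda):a\subseteq b\}=\emptyset$ for some $a\in P_\kappa(\lambda)$. ''Ideal on $P_\kappa(\lambda)$'' always means an ideal $H$ on $P_\kappa(\lambda)$ that is $\kappa$-complete (closed under unions of fewer than $\kappa$ members) and fine ($I_{\kappa,\lambda}\subseteq H$). $\mathfrak d^\kappa_{\kappa,\lambda}$ is the least cardinality of an $F\subseteq{}^\kappa(P_\kappa(\lambda))$ such that for every $g\in{}^\kappa(P_\kappa(\lambda))$ there is $f\in F$ with $g(\alpha)\subseteq f(\alpha)$ for all $\alpha\in\kappa$. For an ideal $H$ on $P_\kappa(\lambda)$, $\mathcal M_H^{\ge\kappa}$ is the set of all $Q\subseteq H^+$ such that (i) $|Q|\ge\kappa$, (ii) $A\cap B\in H$ for all distinct $A,B\in Q$, and (iii)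 for every $C\in H^+$ there is $A\in Q$ with $A\cap C\in H^+$. $\mathfrak a_H$ is the least cardinality of a member of $\mathcal M_H^{\ge\kappa}$ if $\mathcal M_H^{\ge\kappa}\neq\emptyset$, and $2^{(\lambda^{<\kappa})^+}$ otherwise. $H$ is a weak $\pi$-point if for every $f\in{}^\kappa H$ and $A\in H^+$ there is $B\in H^+\cap P(A)$ such that $B\cap f(\alpha)\in I_{\kappa,\lambda}$ for every $\alpha\in\kappa$. *)

(* Defs.v *)
From mathcomp Require Import all_boot.
From mathcomp Require Import boolp classical_sets functions cardinality wochoice.

Set Implicit Arguments.
Unset Strict Implicit.
Unset Printing Implicit Defensive.

Local Open Scope classical_set_scope.
Local Open Scope card_scope.

Definition card_lt T U (A : set T) (B : set U) : Prop :=
  A #<= B /\ ~ (B #<= A).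
Notation "A '#<' B" := (card_lt A B) (at level 79) : card_scope.

(* A cardinal is an initial ordinal: a well-ordered type whose proper initial
   segments all have strictly smaller cardinality.  All other cardinalities
   below (of sets of sets, of invariants) are represented by a type or a set
   having that cardinality, and compared through [#<=], [#<], [#=]. *)
Record cardinal := Cardinal {
  card_sort :> Type;
  card_ord : rel card_sort;
  card_ord_wo : well_order card_ord;
  card_ord_initial : forall x : card_sort,
    [set y | card_ord y x /\ y <> x] #< [set: card_sort]
}.

Definition segment (mu : cardinal) (x : mu) : set mu :=
  [set y | card_ord y x /\ y <> x].

(* A member of [P] of least cardinality; one exists as soon as [P] is nonempty
   (see [least_cardP]), and its cardinality does not depend on the choice. *)
Definition least_card T (P : set (set T)) : set T :=
  xget set0 [set A | P A /\ forall B, P B -> A #<= B].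

Lemma exists_least_card T (P : set (set T)) :
  P !=set0 -> exists A, P A /\ forall B, P B -> A #<= B.
Proof.
move=> P0.
pose good (S : set (set T -> T)) := (forall f A, S f -> P A -> A (f A)) /\
  (forall f g A, S f -> S g -> P A -> f A = g A -> f = g).
have [F Fgood Ftot|S [[Sin Sdis] Smax]] := @Zorn_bigcup _ good.
  split=> [f A [X FX Xf]|f g A [X FX Xf] [Y FY Yg] PA].
    exact: (Fgood _ FX).1.
  by have [XY|YX] := Ftot _ _ FX FY;
    [apply: (Fgood _ FY).2 PA; first exact: XY
    |apply: (Fgood _ FX).2 PA; last exact: YX].
have [A PA Asurj] : exists2 A, P A & forall x, A x -> exists2 f, S f & f A = x.
  apply: contrapT => nA.
  have /choice[h hP] : forall A, exists x,
      P A -> A x /\ forall f, S f -> f A <> x.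
    move=> A; have [PA|nPA] := pselect (P A); last first.
      case: P0 => B PB; have [[x _]|T0] := pselect (exists x : T, True).
        by exists x => /nPA.
      by case: nA; exists B => // x; case: T0; exists x.
    apply: contrapT => nx; apply: nA; exists A => // x Ax.
    apply: contrapT => nf; apply: nx; exists x => _; split=> // f Sf fAx.
    by apply: nf; exists f.
  have nSh : ~ S h.
    by case: P0 => B PB Sh; have [_ /(_ _ Sh)] := hP _ PB.
  apply: (Smax (S `|` [set h])).
    split; last by move=> /(_ h (or_intror erefl)).
    by move=> f Sf; left.
  split=> [f A [Sf|->] PA|f g A [Sf|->] [Sg|->] PA fg] //.
  - exact: (Sin f A Sf PA).
  - by have [] := hP _ PA.
  - exact: (Sdis f g A Sf Sg PA fg).
  - by have [_ /(_ _ Sf)] := hP _ PA.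
  - by have [_ /(_ _ Sg)] := hP _ PA; rewrite fg.
exists A; split=> // B PB.
have /choice[s sP] : forall x : A, exists f, S f /\ f A = val x.
  by case=> x xA; have [f] := Asurj x (set_mem xA); exists f.
have sB (x : A) : s x B \in B by have [Sx _] := sP x; exact: mem_set (Sin _ _ Sx PB).
pose t (x : A) : B := exist _ (s x B) (sB x).
have tinj : {in [set: A] &, injective t}.
  move=> x y _ _ /(congr1 val) /= sxy; apply: val_inj.
  have [Sx <-] := sP x; have [Sy <-] := sP y.
  by rewrite (Sdis _ _ _ Sx Sy PB sxy).
have /card_eqPle[_ leA] := inj_card_eq tinj.
have leB : t @` [set: A] #<= [set: B] by exact: subset_card_le.
have /card_eqPle[_ le1] := card_setT A.
have /card_eqPle[le2 _] := card_setT B.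
exact: card_le_trans le1 (card_le_trans leA (card_le_trans leB le2)).
Qed.

Lemma least_cardP T (P : set (set T)) : P !=set0 ->
  P (least_card P) /\ forall B, P B -> least_card P #<= B.
Proof.
by move=> /exists_least_card/(@xgetPex _ set0).
Qed.

Definition cofinality (mu : cardinal) : set mu :=
  least_card [set A : set mu | forall x, exists2 y, A y & card_ord x y].

Arguments cofinality : clear implicits.

Definition regular (mu : cardinal) : Prop :=
  infinite_set [set: mu] /\ cofinality mu #= [set: mu].

Definition uncountable_cardinal (mu : cardinal) : Prop :=
  ~ countable [set: mu].

(* The cardinal successor of |T|: the least cardinal above |T|, looked for among
   the subsets of the power set of T (which suffices by Cantor's theorem). *)
Definition succ_card (T : Type) : set (set T) :=
  least_card [set A : set (set T) | [set: T] #< A].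

Arguments succ_card : clear implicits.

(* mu^{<nu}: functions from an ordinal below nu to mu *)
Definition weak_power (mu nu : cardinal) : Type :=
  {alpha : nu & segment alpha -> mu}.

Section Ideals.
Variable S : Type.
Implicit Types K : set (set S).

Definition is_ideal K : Prop :=
  [/\ infinite_set [set: S],
      forall x, K [set x],
      forall A B, A `<=` B -> K B -> K A,
      forall A B, K A -> K B -> K (A `|` B)
    & ~ K [set: S]].

Definition positive K : set (set S) := ~` K.

Definition cof K : set (set S) :=
  least_card [set X : set (set S) |
    X `<=` K /\ K = \bigcup_(A in X) [set B | B `<=` A]].

Definition complete (kappa : cardinal) K : Prop :=
  forall X : set (set S), X `<=` K -> X #< [set: kappa] ->
    K (\bigcup_(A in X) A).

End Ideals.

Section PKappaLambda.
Variables kappa lambda : cardinal.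

Definition Pk : Type := set_type [set a : set lambda | a #< [set: kappa]].

Definition subP (a b : Pk) : Prop := val a `<=` val b.

Definition I_kl : set (set Pk) :=
  [set A | exists a : Pk, A `&` [set b | subP a b] = set0].

Definition ideal_on_Pk (H : set (set Pk)) : Prop :=
  [/\ is_ideal H, complete kappa H & I_kl `<=` H].

Definition dominating_number : set (kappa -> Pk) :=
  least_card [set F : set (kappa -> Pk) |
    forall g : kappa -> Pk, exists2 f, F f &
      forall alpha, subP (g alpha) (f alpha)].

Definition mad_families (H : set (set Pk)) : set (set (set Pk)) :=
  [set Q | [/\ Q `<=` positive H,
    [set: kappa] #<= Q,
    forall A B, Q A -> Q B -> A <> B -> H (A `&` B)
  & forall C, positive H C -> exists2 A, Q A & positive H (A `&` C)]].

(* A type of cardinality a_H; the "else" branch has cardinality 2^{(lambda^{<kappa})^+}. *)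
Definition a_number (H : set (set Pk)) : Type :=
  if pselect (mad_families H !=set0)
  then set_type (least_card (mad_families H))
  else set (set_type (succ_card (weak_power lambda kappa))).

Definition weak_pi_point (H : set (set Pk)) : Prop :=
  forall (f : kappa -> set Pk) (A : set Pk),
    (forall alpha, H (f alpha)) -> positive H A ->
    exists B, [/\ positive H B, B `<=` A &
      forall alpha, I_kl (B `&` f alpha)].

End PKappaLambda.
Arguments dominating_number : clear implicits.
Arguments I_kl : clear implicits.

(* Main.v *)
Require Import Defs.
From mathcomp Require Import all_boot.
From mathcomp Require Import boolp classical_sets functions cardinality wochoice.

Set Implicit Arguments.
Unset Strict Implicit.

Local Open Scope classical_set_scope.
Local Open Scope card_scope.

(** Let [f : kappa -> P(P_kappa(lambda))] and [A] be such that every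
    [A \ \bigcup_(b < a) f b] is [H]-positive, and let [X] be cofinal in [H] with
    [|X| = cof H].  For [C] in [X] choose [g_C a] in [A], outside [C] and outside
    every [f b], [b < a].  The [g_C] are too few to be dominating, so some
    [h : kappa -> P_kappa(lambda)] is dominated by no [g_C]; replacing [h a] by
    [\bigcup_(b <= a) h b], put [B := {x in A | forall a, x in f a -> ~ h a <= x}].
    Each [B /\ f a] lies in [I_kl], and if [~ h a <= g_C a] then [g_C a] is a point
    of [B \ C], so [B] is positive.  When the [f a] lie in [H] this is the weak
    pi-point property; when they enumerate an [H]-almost disjoint family of size
    [kappa] (and [A] is the whole space), [B] refutes its maximality. *)

(* [fintype] has another [card_ord]. *)
Local Notation card_ord := Defs.card_ord.

(** * Comparison of cardinalities *)

Lemma set_inj_card_le {T U} {A : set T} {B : set U} {f : T -> U} :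
  set_fun A B f -> set_inj A f -> A #<= B.
Proof.
move=> fAB finj.
have /injfunPex[g] : exists2 f : T -> U, set_fun A B f & set_inj A f by exists f.
exact: inj_card_le.
Qed.

Lemma card_setT_leP T U (B : set U) :
  [set: T] #<= B <-> exists f : T -> U, (forall x, B (f x)) /\ injective f.
Proof.
split=> [/card_leP[f]|[f [fB finj]]]; last first.
  by apply: (@set_inj_card_le _ _ _ _ f) => // x y _ _ /finj.
exists (fun x => val (f (SigSub (mem_set (I : [set: T] x))))); split.
  by move=> x; apply: set_valP.
move=> x y /val_inj /(inj (mem_set I) (mem_set I)).
by move/(congr1 val).
Qed.

(** Copies of [A] and [B] inside [T + U] form a nonempty family of sets over one type; its member of
    least cardinality embeds in the other. *)
Lemma card_le_total T U (A : set T) (B : set U) : A #<= B \/ B #<= A.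
Proof.
have /card_eqPle[lA gA] : (@inl T U) @` A #= A by apply: inj_card_eq => x y _ _ [].
have /card_eqPle[lB gB] : (@inr T U) @` B #= B by apply: inj_card_eq => x y _ _ [].
have [|C [CAB Cmin]] := @exists_least_card _ [set (@inl T U) @` A; (@inr T U) @` B].
  by eexists; left.
case: CAB Cmin => -> Cmin; [left|right].
  by apply: card_le_trans gA (card_le_trans (Cmin _ _) lB); right.
by apply: card_le_trans gB (card_le_trans (Cmin _ _) lA); left.
Qed.

Lemma card_ltNge T U (A : set T) (B : set U) : A #< B <-> ~ (B #<= A).
Proof.
split=> [[]//|nBA]; split=> //.
by have [//|/nBA] := card_le_total A B.
Qed.

Lemma card_le_ltT T U V (A : set T) (B : set U) (C : set V) :
  A #<= B -> B #< C -> A #< C.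
Proof. by move=> AB [_ nCB]; apply/card_ltNge => /card_le_trans/(_ AB). Qed.

Lemma card_lt_leT T U V (A : set T) (B : set U) (C : set V) :
  A #< B -> B #<= C -> A #< C.
Proof. by move=> [_ nBA] BC; apply/card_ltNge => /(card_le_trans BC). Qed.

Lemma card_lt_powerset T : [set: T] #< [set: set T].
Proof.
apply/card_ltNge => /card_setT_leP[f [_ finj]].
pose D := [set x | exists2 A, f A = x & ~ A x].
have [DfD|nDfD] := pselect (D (f D)); last by apply: (nDfD); exists D.
by have [A /finj ->] := DfD.
Qed.

(** * Order axioms for a cardinal *)

Section WellOrder.
Variable mu : cardinal.
Implicit Types x y z : mu.

(** A well-order is given only by unique least elements of nonempty subsets, so the order axioms are
    read off from the least elements of sets of two or three points. *)
Lemma card_ord_total x y : card_ord x y \/ card_ord y x.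
Proof.
have [|z [[]]] := @card_ord_wo mu (fun t => `[< t = x \/ t = y >]).
  by exists x; apply/asboolP; left.
move=> /asboolP zxy zmin _; have zx : card_ord z x by apply: zmin; apply/asboolP; left.
have zy : card_ord z y by apply: zmin; apply/asboolP; right.
by case: zxy => zE; subst z; [left|right].
Qed.

Lemma card_ord_refl x : card_ord x x.
Proof. by have [] := card_ord_total x x. Qed.

Lemma card_ord_anti x y : card_ord x y -> card_ord y x -> x = y.
Proof.
move=> xy yx; have [|z [_ zuniq]] := @card_ord_wo mu (fun t => `[< t = x \/ t = y >]).
  by exists x; apply/asboolP; left.
rewrite -(zuniq x) ?(zuniq y) //; split; try by apply/asboolP; auto.
  by move=> t /asboolP[]->; rewrite ?card_ord_refl.
by move=> t /asboolP[]->; rewrite ?card_ord_refl.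
Qed.

Lemma card_ord_trans x y z : card_ord x y -> card_ord y z -> card_ord x z.
Proof.
move=> xy yz; have [|t [[]]] := @card_ord_wo mu (fun t => `[< [\/ t = x, t = y | t = z] >]).
  by exists x; apply/asboolP; constructor.
move=> /asboolP txyz tmin _.
have tx : card_ord t x by apply: tmin; apply/asboolP; constructor.
have ty : card_ord t y by apply: tmin; apply/asboolP; constructor.
have tz : card_ord t z by apply: tmin; apply/asboolP; constructor.
case: txyz => tE; subst t => //; first by rewrite (card_ord_anti xy tx).
by rewrite -(card_ord_anti yz ty).
Qed.

End WellOrder.

(** * Consequences of regularity *)

Section Regular.
Variable kappa : cardinal.
Hypothesis kappa_reg : regular kappa.

(** Otherwise [D] would be cofinal, hence at least as large as the cofinality, which is [kappa]. *)
Lemma regular_bounded (D : set kappa) : D #< [set: kappa] ->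
  exists x, forall y, D y -> ~ card_ord x y.
Proof.
move=> [_ nD]; apply: contrapT => nb; apply: nD.
have Dcof : [set A : set kappa | forall x, exists2 y, A y & card_ord x y] D.
  move=> x; apply: contrapT => nx; apply: nb; exists x => y Dy xy.
  by apply: nx; exists y.
have [_ /(_ _ Dcof)] := least_cardP (ex_intro _ D Dcof).
by apply: card_le_trans; have [_ /card_eqPle[]] := kappa_reg.
Qed.

Lemma card_closed_segment_lt (x : kappa) :
  [set y | card_ord y x] #< [set: kappa].
Proof.
(* [card_ord_initial] bounds strict segments only, so the closed segment of [x] is placed in the
   strict segment of some [z] above [x]. *)
have [|z zx] := @regular_bounded [set x].
  by apply/card_ltNge => /card_le_finite/(_ (finite_set1 x)); case: kappa_reg.
apply: card_le_ltT (card_ord_initial z); apply: subset_card_le => y /= yx.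
split=> [|yz]; last by apply: (zx x); rewrite -?yz.
have [//|zy] := card_ord_total y z.
by case: (zx x) => //; exact: card_ord_trans zy yx.
Qed.

(* If [g] embeds [kappa] in the union, each [g @^-1` F y] is bounded by some
   [b y]; a common bound of the [b y] then lies in none of these preimages. *)
Lemma regular_bigcup_lt T (D : set kappa) (F : kappa -> set T) :
  D #< [set: kappa] -> (forall y, D y -> F y #< [set: kappa]) ->
  \bigcup_(y in D) F y #< [set: kappa].
Proof.
move=> Dlt Flt; apply/card_ltNge => /card_setT_leP[g [gF ginj]].
have /choice[b bP] : forall y, exists b,
    D y -> forall z, F y (g z) -> ~ card_ord b z.
  move=> y; have [Dy|nDy] := pselect (D y); last first.
    by have [z _] := regular_bounded Dlt; exists z.
  have [|z zP] := @regular_bounded [set z | F y (g z)]; last by exists z.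
  by apply: card_le_ltT (Flt _ Dy); apply: (@set_inj_card_le _ _ _ _ g) => // u v _ _ /ginj.
have [|z zP] := @regular_bounded (b @` D).
  exact: card_le_ltT (card_image_le _ _) Dlt.
have [y Dy Fyz] := gF z.
have [|/(bP _ Dy _ Fyz)//] := card_ord_total z (b y).
by apply: zP; exists y.
Qed.

End Regular.

(** * The diagonal construction and its two applications *)

Section DiagonalSet.
Variables kappa lambda : cardinal.
Hypothesis kappa_reg : regular kappa.
Variable H : set (set (Pk kappa lambda)).
Hypothesis H_ideal : ideal_on_Pk H.
Hypothesis cof_lt_d : cof H #< dominating_number kappa lambda.

Lemma not_dominating (F : set (kappa -> Pk kappa lambda)) :
  F #<= cof H ->
  exists h : kappa -> Pk kappa lambda,
    forall f, F f -> exists alpha, ~ subP (h alpha) (f alpha).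
Proof.
move=> Fle; apply: contrapT => nh.
have Fdom : forall g : kappa -> Pk kappa lambda, exists2 f, F f &
    forall alpha, subP (g alpha) (f alpha).
  move=> g; apply: contrapT => nf; apply: nh; exists g => f Ff.
  by apply: contrapT => nal; apply: nf; exists f => // alpha; apply: contrapT => ?;
    apply: nal; exists alpha.
have [_ /(_ F Fdom) dF] := least_cardP (ex_intro
  (fun F : set (kappa -> Pk kappa lambda) => forall g, exists2 f, F f &
    forall alpha, subP (g alpha) (f alpha)) F Fdom).
by case: cof_lt_d => _; apply; apply: card_le_trans dF Fle.
Qed.

Lemma cof_cofinal :
  cof H `<=` H /\ forall A, H A -> exists2 C, cof H C & A `<=` C.
Proof.
case: H_ideal => -[_ _ Hsub _ _] _ _.
have [|[cofH HE] _] := @least_cardP _ [set X : set (set (Pk kappa lambda)) |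
    X `<=` H /\ H = \bigcup_(A in X) [set B | B `<=` A]].
  exists H; split=> //; apply/seteqP; split=> [A HA|B [A HA BA]]; first by exists A.
  exact: Hsub BA HA.
split=> // A; rewrite {1}HE => -[C XC AC].
by exists C.
Qed.

Lemma positive_diagonal (f : kappa -> set (Pk kappa lambda))
    (A : set (Pk kappa lambda)) :
  (forall alpha, positive H (A `\` \bigcup_(beta in segment alpha) f beta)) ->
  exists B, [/\ positive H B, B `<=` A & forall alpha, I_kl kappa lambda (B `&` f alpha)].
Proof.
move=> Apos; have [cofH cofP] := cof_cofinal.
have Hsub : forall A B, A `<=` B -> H B -> H A by case: H_ideal => -[].
have /choice[g gP] : forall C, exists g : kappa -> Pk kappa lambda, cof H C ->
    forall alpha, [/\ A (g alpha), ~ C (g alpha) &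
      forall beta, segment alpha beta -> ~ f beta (g alpha)].
  move=> C; have [/cofH HC|nC] := pselect (cof H C); last first.
    (* Off [cof H] any function serves; the empty family supplies one. *)
    by have [h _] := not_dominating (card_ge0 _ (cof H)); exists h.
  suff /choice[g gP] : forall alpha, exists b, [/\ A b, ~ C b &
      forall beta, segment alpha beta -> ~ f beta b] by exists g.
  move=> alpha; apply: contrapT => nb; apply: (Apos alpha); apply: Hsub HC.
  move=> b [Ab nfb]; apply: contrapT => nCb; apply: nb; exists b; split=> //.
  by move=> beta ab fb; apply: nfb; exists beta.
have [h hP] := not_dominating (card_image_le g (cof H)).
(* These unions make [k] increasing with [h alpha] inside [k alpha]; regularity keeps each of them
   of size below [kappa]. *)
pose k_set alpha := \bigcup_(beta in [set y | card_ord y alpha]) val (h beta).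
have k_lt alpha : [set a : set lambda | a #< [set: kappa]] (k_set alpha).
  apply: (regular_bigcup_lt kappa_reg); first exact: card_closed_segment_lt.
  by move=> y _; exact: set_valP (h y).
pose k alpha : Pk kappa lambda := SigSub (mem_set (k_lt alpha)).
exists [set b | A b /\ forall alpha, f alpha b -> ~ subP (k alpha) b]; split.
- move=> /cofP[C cofC BC].
  have [|alpha nh] := hP (g C); first by exists C.
  have gC := gP _ cofC alpha; case: gC => Ag nCg nfg.
  apply: nCg; apply: BC; split=> // beta fbg kb.
  (* For [beta] from [alpha] on, [k beta] contains [h alpha], which is not included in [g C alpha];
     for [beta] strictly below [alpha], [g C alpha] was chosen outside [f beta]. *)
  have [ab|ba] := card_ord_total alpha beta.
    by apply: nh => x hx; apply: kb; exists alpha.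
  have [bE|bN] := pselect (beta = alpha); last exact: (nfg beta).
  by apply: nh => x hx; apply: kb; exists alpha => //=; rewrite bE; apply: card_ord_refl.
- by move=> b [].
- move=> alpha; exists (k alpha); apply/seteqP; split=> // b [[[_ nk] fb] kb].
  exact: nk fb kb.
Qed.

Lemma weak_pi_point_of_cof_lt : weak_pi_point H.
Proof.
move=> f A Hf PA; apply: positive_diagonal => alpha HAf; apply: PA.
case: H_ideal => -[_ _ Hsub HU _] Hcomp _.
(* Fewer than [kappa] sets precede [alpha], so completeness puts their union in [H], and removing it
   from [A] leaves a positive set. *)
have Hf' : H (\bigcup_(B in f @` segment alpha) B).
  apply: Hcomp => [_ [beta _ <-]//|].
  exact: card_le_ltT (card_image_le _ _) (card_ord_initial alpha).
apply: Hsub (HU _ _ HAf Hf') => b Ab.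
have [[beta ab fb]|nf] := pselect ((\bigcup_(beta in segment alpha) f beta) b).
  by right; exists (f beta) => //; exists beta.
by left.
Qed.

Lemma mad_family_gt (Q : set (set (Pk kappa lambda))) :
  mad_families H Q -> [set: kappa] #< Q.
Proof.
move=> [Qpos kQ Qad Qmax]; split=> // Qk; case: H_ideal => _ _ IH.
have /card_set_bijP[f [fQ finj fsurj]] : [set: kappa] #= Q.
  by rewrite card_eq_le kQ.
have [alpha|B [PB _ BI]] := @positive_diagonal f setT.
  (* [f alpha] meets the union of the earlier members in a set of [H], by almost disjointness and
     completeness; so its part outside that union is positive. *)
  move=> Hdiff; apply: (Qpos (f alpha)); first exact: fQ.
  have Hmeet : H (\bigcup_(B in (fun beta => f alpha `&` f beta) @` segment alpha) B).
    case: H_ideal => _ Hcomp _; apply: Hcomp.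
      move=> _ [beta [_ bNa] <-]; apply: Qad; try exact: fQ.
      by move=> /(finj _ _ (in_setT _) (in_setT _))/esym.
    exact: card_le_ltT (card_image_le _ _) (card_ord_initial alpha).
  case: H_ideal => -[_ _ Hsub HU _] _ _; apply: Hsub (HU _ _ Hdiff Hmeet) => b fb.
  have [[beta ab fbb]|nf] := pselect ((\bigcup_(beta in segment alpha) f beta) b).
    by right; exists (f alpha `&` f beta) => //; exists beta.
  by left.
have [A /fsurj[alpha _ <-]] := Qmax B PB; apply; apply: IH.
by rewrite setIC; apply: BI.
Qed.

End DiagonalSet.

(** * The default value of [a_number], and the conclusion *)

Lemma card_le_weak_power (kappa lambda : cardinal) :
  [set: kappa] #<= [set: lambda] ->
  [set: kappa] #<= [set: weak_power lambda kappa].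
Proof.
move=> /card_setT_leP[f _]; apply/card_setT_leP.
exists (fun alpha => existT (fun beta => segment beta -> lambda) alpha (fun=> f alpha)).
by split=> // x y /(congr1 (@projT1 _ _)).
Qed.

Lemma succ_cardP T : [set: T] #< succ_card T.
Proof.
have [|//] := @least_cardP _ [set A : set (set T) | [set: T] #< A].
by exists setT; exact: card_lt_powerset.
Qed.

Unset Implicit Arguments.
Set Strict Implicit.

Theorem theorem8p4 (kappa lambda : cardinal)
    (kappa_reg : regular kappa) (kappa_unc : uncountable_cardinal kappa)
    (kappa_lt_lambda : [set: kappa] #< [set: lambda])
    (H : set (set (Pk kappa lambda))) (H_ideal : ideal_on_Pk H)
    (cof_lt_d : cof H #< dominating_number kappa lambda) :
  [set: kappa] #< [set: a_number H] /\ weak_pi_point H.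
Proof.
split; last exact (weak_pi_point_of_cof_lt kappa_reg H_ideal cof_lt_d).
rewrite /a_number; case: pselect => [madH|nomad] /=.
  have [lmad _] := least_cardP madH.
  apply: card_lt_leT (mad_family_gt kappa_reg H_ideal cof_lt_d lmad) _.
  by have /card_eqPle[] := card_setT (least_card (mad_families H)).
(* Without mad families, [kappa] is at most [weak_power lambda kappa], which lies below its
   successor, which lies below the power set of that successor. *)
apply: card_lt_leT (card_lt_powerset _).1.
apply: card_le_ltT (card_le_weak_power kappa_lt_lambda.1) _.
apply: card_lt_leT (succ_cardP _) _.
by have /card_eqPle[] := card_setT (succ_card (weak_power lambda kappa)).
Qed.
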